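(* Let $G=(V,(E_i)_{i\in[k]})$ be a multilayer network with positive edge weights $w_i\colon E_i\to\mathbb{R}_{>0}$ $(i\in[k])$, and let $\bm{\alpha}\in\mathbb{R}_{\ge 0}^k$ and $\bm{\beta}\in\mathbb{R}^k$. Then the LP-based algorithm (described in the context) outputs an optimal solution to $(\bm{\alpha},\bm{\beta})$-DENSITY. That is, for any optimal solution $((\hat{x}_e)_{e\in E},(\hat{y}_v)_{v\in V},\hat{t})$ to the LP, the probability distribution $\hat{p}\in\Delta(2^V)$ that the algorithm constructs from it satisfies $$\min_{i\in[k]}\Bigl[\alpha_i\sum_{S\subseteq V}\hat{p}_S\frac{w_i(S)}{|S|}+\beta_i\Bigr]=\max_{p\in\Delta(2^V)}\min_{i\in[k]}\Bigl[\alpha_i\sum_{S\subseteq V}p_S\frac{w_i(S)}{|S|}+\beta_i\Bigr].$$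
   Context: Notation: $[k]=\{1,\dots,k\}$ with $k\ge 1$. A multilayer network $G=(V,(E_i)_{i\in[k]})$ consists of a finite nonempty vertex set $V$ and, for each layer $i\in[k]$, a set $E_i$ of undirected edges $\{u,v\}$ ($u\neq v$, $u,v\in V$). Put $E=\bigcup_{i\in[k]}E_i$. For $S\subseteq V$, $E_i[S]=\{\{u,v\}\in E_i\mid u,v\in S\}$ and $w_i(S)=\sum_{e\in E_i[S]}w_i(e)$. The density of $S$ in layer $i$ is $w_i(S)/|S|$, with the convention that it is $0$ for $S=\emptyset$. $\Delta(2^V)$ is the set of probability distributions on $2^V$; for $p\in\Delta(2^V)$, $p_S$ is the probability of $S\subseteq V$. Problem $(\bm{\alpha},\bm{\beta})$-DENSITY: find $p\in\Delta(2^V)$ maximizing $\min_{i\in[k]}\mathbb{E}_{S\sim p}\bigl[\alpha_i\frac{w_i(S)}{|S|}+\beta_i\bigr]=\min_{i\in[k]}\bigl[\alpha_i\sum_{S\subseteq V}p_S\frac{w_i(S)}{|S|}+\beta_i\bigr]$. The LP, in real variables $((x_e)_{e\in E},(y_v)_{v\in V},t)$: maximize $t$ subject to $t\le\alpha_i\sum_{e\in E_i}w_i(e)x_e+\beta_i$ for all $i\in[k]$; $x_e\le y_u$ and $x_e\le y_v$ for all $e=\{u,v\}\in E$; $\sum_{v\in V}y_v=1$; $x_e\ge 0$ and $y_v\ge 0$ for all $e\in E$, $v\in V$. LP-based algorithm: (1) compute an optimal solution $((\hat{x}_e)_{e\in E},(\hat{y}_v)_{v\in V},\hat{t})$ to the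 LP. (2) Let $0=r_0<r_1<\cdots<r_\ell$ be the reals with $\{r_0,r_1,\dots,r_\ell\}=\{\hat{y}_v\mid v\in V\}\cup\{0\}$. (3) Let $S_j=\{v\in V\mid\hat{y}_v\ge r_j\}$ for $j=1,\dots,\ell$. (4) Return $\hat{p}\in\Delta(2^V)$ with $\hat{p}_{S_j}=(r_j-r_{j-1})\cdot|S_j|$ for $j=1,\dots,\ell$ and $\hat{p}_S=0$ for all other $S\subseteq V$. *)

(* Defs.v *)
From HB Require Import structures.
From mathcomp Require Import all_boot all_order all_algebra.
From mathcomp Require Import reals.
Set Implicit Arguments.
Unset Strict Implicit.
Unset Printing Implicit Defensive.
Import Order.TTheory GRing.Theory Num.Theory.
Local Open Scope ring_scope.

(* The number of layers is written k.+1, so that it is at least 1 and the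
   minimum over the layers is well defined. An edge is a 2-element vertex set. *)
Record multilayer (V : finType) (k : nat) := Multilayer {
  layer :> 'I_k.+1 -> {set {set V}};
  card_edge : forall i e, e \in layer i -> #|e| = 2%N }.

(* Edge weights [w i] and edge variables [x] are total functions on {set V};
   their values are only ever used on edges of [G i], resp. of [edges G]. *)

Section Density.
Context (R : realType) (V : finType) (k : nat).
Variables (G : multilayer V k) (w : 'I_k.+1 -> {set V} -> R).
Variables (alpha beta : 'I_k.+1 -> R).

Definition edges : {set {set V}} := \bigcup_(i < k.+1) G i.

Definition induced_edges (i : 'I_k.+1) (S : {set V}) : {set {set V}} :=
  [set e in G i | e \subset S].

Definition weight (i : 'I_k.+1) (S : {set V}) : R :=
  \sum_(e in induced_edges i S) w i e.

(* Equal to 0 for S = set0, since 0^-1 = 0 in R. *)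
Definition density (i : 'I_k.+1) (S : {set V}) : R := weight i S / #|S|%:R.

Definition is_distr (p : {set V} -> R) : Prop :=
  (forall S, 0 <= p S) /\ \sum_(S : {set V}) p S = 1.

Definition min_layers (f : 'I_k.+1 -> R) : R :=
  \big[Num.min/f ord0]_(i < k.+1) f i.

Definition objective (p : {set V} -> R) : R :=
  min_layers (fun i => alpha i * (\sum_(S : {set V}) p S * density i S) + beta i).

Definition density_optimal (p : {set V} -> R) : Prop :=
  is_distr p /\ forall q, is_distr q -> objective q <= objective p.

Definition lp_feasible (x : {set V} -> R) (y : V -> R) (t : R) : Prop :=
  [/\ forall i, t <= alpha i * (\sum_(e in G i) w i e * x e) + beta i,
      forall u v, [set u; v] \in edges ->
        x [set u; v] <= y u /\ x [set u; v] <= y v,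
      \sum_v y v = 1,
      forall e, e \in edges -> 0 <= x e
    & forall v, 0 <= y v].

Definition lp_optimal (x : {set V} -> R) (y : V -> R) (t : R) : Prop :=
  lp_feasible x y t /\ forall x' y' t', lp_feasible x' y' t' -> t' <= t.

End Density.

Section Rounding.
Context (R : realType) (V : finType).
Variable y : V -> R.

(* The increasing sequence r_0 < r_1 < ... < r_ell. *)
Definition levels : seq R := sort <=%O (undup (0 :: codom y)).

Definition level (j : nat) : R := nth 0 levels j.

Definition nlevels : nat := (size levels).-1.

Definition level_set (j : nat) : {set V} := [set v | level j <= y v].

(* The level sets S_1, ..., S_ell are pairwise distinct when y is nonnegative,
   so the sum has at most one term: see rounding_level_set and rounding_other. *)
Definition rounding (S : {set V}) : R :=
  \sum_(1 <= j < nlevels.+1 | S == level_set j)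
     (level j - level j.-1) * #|level_set j|%:R.

Lemma levels_sorted : sorted <%O levels.
Proof. by rewrite sort_lt_sorted undup_uniq. Qed.

Lemma mem_levels : levels =i 0 :: codom y.
Proof. by move=> z; rewrite mem_sort mem_undup. Qed.

Lemma size_levels : size levels = nlevels.+1.
Proof.
have := mem_levels 0; rewrite /nlevels inE eqxx.
by case: levels.
Qed.

Lemma level_lt i j : (i < j <= nlevels)%N -> level i < level j.
Proof.
case/andP=> ij jn; apply: (sorted_ltn_nth lt_trans 0 levels_sorted) => //;
  rewrite inE size_levels ltnS //; exact: leq_trans (ltnW ij) jn.
Qed.

Hypothesis y_ge0 : forall v, 0 <= y v.

Lemma level0 : level 0 = 0.
Proof.
have h j : (j <= nlevels)%N -> 0 <= level j.
  move=> jn; have : level j \in levels by rewrite mem_nth // size_levels.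
  by rewrite mem_levels inE => /orP[/eqP->//|/codomP[v ->]].
have : 0 \in levels by rewrite mem_levels inE eqxx.
move/(nthP 0) => [[|j]]; rewrite size_levels ltnS // => jn jE.
by have := @level_lt 0 j.+1 jn; rewrite [level j.+1]jE ltNge h.
Qed.

Lemma level_set_inj i j : (0 < i <= nlevels)%N -> (0 < j <= nlevels)%N ->
  level_set i = level_set j -> i = j.
Proof.
have wlog_lt a b : (0 < a)%N -> (a < b <= nlevels)%N ->
    level_set a <> level_set b.
  move=> a0 /andP[ab bn] /setP E.
  have an : (a <= nlevels)%N := leq_trans (ltnW ab) bn.
  have : level a \in levels by rewrite mem_nth // size_levels.
  have a_gt0 : 0 < level a by rewrite -level0 level_lt // a0.
  rewrite mem_levels inE gt_eqF //= => /codomP[v va].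
  have := E v; rewrite !inE -va lexx => /esym.
  by rewrite leNgt level_lt // ab.
move=> /andP[i0 hi] /andP[j0 hj] E; case: (ltngtP i j) => // ij.
- by case: (wlog_lt i j); rewrite ?ij.
- by case: (wlog_lt j i); rewrite ?ij.
Qed.

Lemma rounding_level_set j : (0 < j <= nlevels)%N ->
  rounding (level_set j) = (level j - level j.-1) * #|level_set j|%:R.
Proof.
move=> hj; rewrite /rounding big_mkcond (bigD1_seq j) ?iota_uniq //=; last first.
  by rewrite mem_index_iota ltnS.
rewrite eqxx big_seq_cond big1 ?addr0 // => i /andP[].
rewrite mem_index_iota ltnS => hi ne; case: eqP => // E.
by rewrite (level_set_inj hj hi E) eqxx in ne.
Qed.

Lemma rounding_other S :
  (forall j, (0 < j <= nlevels)%N -> S <> level_set j) -> rounding S = 0.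
Proof.
move=> h; rewrite /rounding big_nat_cond big1 // => j /andP[].
by rewrite ltnS => hj /eqP /(h _ hj).
Qed.

End Rounding.

(* Main.v *)
Require Import Defs.
From HB Require Import structures.
From mathcomp Require Import all_boot all_order all_algebra.
From mathcomp Require Import reals.
Set Implicit Arguments.
Unset Strict Implicit.
Unset Printing Implicit Defensive.
Import Order.TTheory GRing.Theory Num.Theory.
Local Open Scope ring_scope.

(** Charikar's argument, applied to all the layers at once. A distribution q
    yields an LP solution with the same value in every layer: put
    x_e = \sum_(S | e \subset S) q_S / |S| and
    y_v = \sum_(S | v \in S) q_S / |S|, the mass of the empty set being spread
    uniformly over the y_v so that they sum to 1. Conversely, the layer cake
    formula shows that rounding y has expected density
    \sum_(e = {u, v} in E_i) w_i(e) min(y_u, y_v) in layer i, which is at least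
    the value of the LP solution in layer i because x_e <= min(y_u, y_v). *)

Section MinLayers.
Context (R : realType) (k : nat).
Implicit Type f : 'I_k.+1 -> R.

Lemma min_layers_le f i : min_layers f <= f i.
Proof. exact: bigmin_le_cond. Qed.

Lemma le_min_layers f a : (forall i, a <= f i) -> a <= min_layers f.
Proof.
move=> le_af; rewrite /min_layers; elim/big_ind: _ => // b c ab ac.
by rewrite le_min ab.
Qed.

End MinLayers.

Section Rounding.
Context (R : realType) (V : finType) (y : V -> R).
Hypothesis y_ge0 : forall v, 0 <= y v.

Lemma level_le m j : (m <= nlevels y)%N -> (j <= nlevels y)%N ->
  (level y j <= level y m) = (j <= m)%N.
Proof.
move=> mn jn; case: (ltngtP j m) => [jm|mj|->]; last exact: lexx.
- by rewrite ltW // level_lt // jm.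
- by rewrite leNgt level_lt // mj.
Qed.

(** Layer cake formula: [y v] is itself some level [level y m], so the sum runs over j = 1, ..., m
    and telescopes down to [level y 0], which is 0. *)
Lemma sum_level_increments v :
  \sum_(1 <= j < (nlevels y).+1 | level y j <= y v)
     (level y j - level y j.-1) = y v.
Proof.
have : y v \in levels y by rewrite mem_levels inE codom_f orbT.
move=> /(nthP 0)[m]; rewrite size_levels ltnS => mn yvE.
have {yvE} <- : level y m = y v by [].
rewrite -[RHS]subr0 -[X in _ = _ - X](level0 y_ge0).
rewrite -(telescope_sumr (level y)) //.
rewrite -(big_add1 _ _ 0 m.+1 xpredT (fun j => level y j - level y j.-1)).
(* Both sums now range over all levels; the bound j <= m becomes a filter, which [level_le]
   identifies with the one on levels. *)
rewrite (big_nat_widen 1 m.+1 (nlevels y).+1) //.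
rewrite [LHS]big_nat_cond [RHS]big_nat_cond; apply: eq_bigl => j.
by apply: andb_id2l => /andP[_]; rewrite !ltnS => jn; rewrite level_le.
Qed.

(** Once the sums are exchanged, each index j selects the single set [level_set y j]. *)
Lemma sum_rounding (f : {set V} -> R) :
  \sum_(S : {set V}) rounding y S * f S =
  \sum_(1 <= j < (nlevels y).+1)
     (level y j - level y j.-1) * #|level_set y j|%:R * f (level_set y j).
Proof.
under eq_bigr do rewrite mulr_suml big_mkcond.
rewrite exchange_big; apply: eq_bigr => j _ /=.
by rewrite -big_mkcond big_pred1_eq.
Qed.

Lemma rounding_distr : \sum_v y v = 1 -> is_distr (rounding y).
Proof.
move=> sum_y; split=> [S|].
  rewrite /rounding big_nat_cond sumr_ge0 // => -[//|j] /andP[/andP[_ jn] _].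
  by rewrite mulr_ge0 ?ler0n // subr_ge0 level_le // ltnW.
under eq_bigr do rewrite -[rounding _ _]mulr1.
rewrite (sum_rounding (fun=> 1)) -[RHS]sum_y.
(* Double counting: both sides sum the j-th increment over the pairs (j, v) with v in
   [level_set y j]. *)
under [RHS]eq_bigr do rewrite -sum_level_increments big_mkcond.
rewrite exchange_big; apply: eq_bigr => j _ /=.
rewrite -big_mkcond mulr1 -sum1_card natr_sum mulr_sumr /=.
by apply: eq_big => [v|v _]; rewrite ?inE ?mulr1.
Qed.

Variables (k : nat) (G : multilayer V k) (w : 'I_k.+1 -> {set V} -> R).

Lemma card_mul_density i (S : {set V}) :
  #|S|%:R * density G w i S = weight G w i S.
Proof.
have [/eqP|S_neq0] := eqVneq #|S| 0%N; last first.
  by rewrite mulrC divfK // pnatr_eq0.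
(* The empty set induces no edge, since an edge has two vertices; so its weight is 0 as well. *)
rewrite cards_eq0 => /eqP ->; rewrite cards0 mul0r /weight big1 // => e.
by rewrite inE subset0 => /andP[/card_edge e2 /eqP e0]; rewrite e0 cards0 in e2.
Qed.

(** A level set contains both endpoints exactly when its level is at most the minimum, which is one
    of [y u] and [y v], so the layer cake formula applies. *)
Lemma sum_increments_edge u v :
  \sum_(1 <= j < (nlevels y).+1 | [set u; v] \subset level_set y j)
     (level y j - level y j.-1) = Num.min (y u) (y v).
Proof.
under eq_bigl do rewrite subUset !sub1set !inE -le_min.
by rewrite minEle; case: ifP => _; exact: sum_level_increments.
Qed.

Lemma le_rounding_density (x : {set V} -> R) i :
    (forall e, e \in G i -> 0 <= w i e) ->
    (forall u v, [set u; v] \in G i -> x [set u; v] <= Num.min (y u) (y v)) ->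
  \sum_(e in G i) w i e * x e <= \sum_S rounding y S * density G w i S.
Proof.
move=> w_ge0 x_le; rewrite sum_rounding.
(* The cardinality factor in the rounding cancels the denominator of the density, leaving a sum that
   can be compared edge by edge. *)
under [leRHS]eq_bigr do rewrite -mulrA card_mul_density mulr_sumr big_mkcond.
rewrite exchange_big [leLHS]big_mkcond ler_sum // => e _.
under eq_bigr do rewrite inE.
case: ifP => [eG|_] /=; last by rewrite big1.
rewrite -big_mkcond -mulr_suml mulrC ler_wpM2r ?w_ge0 //.
have /eqP/cards2P[u [v] [_ eE]] := card_edge eG.
by rewrite eE sum_increments_edge x_le // -eE.
Qed.

End Rounding.

Section LPSolution.
Context (R : realType) (V : finType) (k : nat).
Variables (G : multilayer V k) (w : 'I_k.+1 -> {set V} -> R).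
Variables (alpha beta : 'I_k.+1 -> R).

Definition lp_edge (q : {set V} -> R) (e : {set V}) : R :=
  \sum_(S : {set V} | e \subset S) q S / #|S|%:R.

Definition lp_vertex (q : {set V} -> R) (v : V) : R :=
  \sum_(S : {set V} | v \in S) q S / #|S|%:R + q set0 / #|V|%:R.

Lemma sum_lp_edge q i :
  \sum_(e in G i) w i e * lp_edge q e = \sum_S q S * density G w i S.
Proof.
under eq_bigr do rewrite mulr_sumr.
rewrite (exchange_big_dep xpredT) //=; apply: eq_bigr => S _.
rewrite /density /weight mulr_suml mulr_sumr.
apply: eq_big => [e|e _]; first by rewrite inE.
by rewrite mulrCA.
Qed.

(** Each nonempty S passes its mass to its vertices in #|S| equal shares; the correction term
    restores the mass of [set0]. *)
Lemma sum_lp_vertex q : (0 < #|V|)%N -> \sum_v lp_vertex q v = \sum_S q S.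
Proof.
move=> V_gt0; rewrite big_split /= sumr_const -[_ *+ #|V|]mulr_natr.
rewrite divfK ?pnatr_eq0 -?lt0n // (exchange_big_dep xpredT) //=.
rewrite [RHS](bigD1 set0) //= addrC; congr (_ + _).
rewrite (bigD1 set0) //= big_pred0 ?add0r; last by move=> v; rewrite inE.
apply: eq_bigr => S S_neq0.
by rewrite sumr_const -[LHS]mulr_natr divfK // pnatr_eq0 cards_eq0.
Qed.

(** Every S that includes e contains v, so the edge sum is a part of the vertex sum, whose terms are
    nonnegative. *)
Lemma lp_edge_le q (v : V) (e : {set V}) :
  (forall S, 0 <= q S) -> v \in e -> lp_edge q e <= lp_vertex q v.
Proof.
move=> q_ge0 ve; rewrite -[leLHS]addr0 lerD ?divr_ge0 //.
rewrite /lp_edge big_mkcond [leRHS]big_mkcond ler_sum // => S _.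
case: ifP => [/subsetP/(_ v ve)->//|_].
by case: ifP => // _; rewrite divr_ge0.
Qed.

Lemma lp_feasible_distr q : (0 < #|V|)%N -> is_distr q ->
  lp_feasible G w alpha beta (lp_edge q) (lp_vertex q)
    (objective G w alpha beta q).
Proof.
move=> V_gt0 [q_ge0 sum_q]; split=> [i|u v _||e _|v].
- by rewrite sum_lp_edge (min_layers_le (fun i => _ * (\sum_S _) + _)).
- by rewrite !lp_edge_le // !inE eqxx ?orbT.
- by rewrite sum_lp_vertex.
- by rewrite sumr_ge0 // => S _; rewrite divr_ge0.
- by rewrite addr_ge0 ?divr_ge0 // sumr_ge0 // => S _; rewrite divr_ge0.
Qed.

End LPSolution.

Theorem theorem5p3 (R : realType) (V : finType) (k : nat)
    (V_nonempty : (0 < #|V|)%N)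
    (G : multilayer V k) (w : 'I_k.+1 -> {set V} -> R)
    (w_gt0 : forall i e, e \in G i -> 0 < w i e)
    (alpha beta : 'I_k.+1 -> R) (alpha_ge0 : forall i, 0 <= alpha i)
    (x : {set V} -> R) (y : V -> R) (t : R)
    (xyt_opt : lp_optimal G w alpha beta x y t) :
  density_optimal G w alpha beta (rounding y).
Proof.
have [[t_le x_le sum_y _ y_ge0] t_max] := xyt_opt.
split=> [|q q_distr]; first exact: rounding_distr.
(* Optimality bounds the value of q by t; it remains to bound t by the value of the rounding in each
   layer. *)
apply: le_trans (t_max _ _ _ (lp_feasible_distr _ _ _ _ V_nonempty q_distr)) _.
apply: le_min_layers => i; apply: le_trans (t_le i) _.
rewrite lerD2r ler_wpM2l // le_rounding_density // => [e /w_gt0/ltW//|u v uvG].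
have [|xu xv] := x_le u v; first by apply/bigcupP; exists i.
by rewrite le_min xu.
Qed.
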